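(* Let $m,n\ge 1$, $\xi\in\mathbb R^m$, $t=\mathrm{lcm}(m,n)$, $\alpha=t/m$, $\beta=t/n$, and write $\xi\otimes\mathbf 1_\alpha=(\eta_1,\dots,\eta_t)^T$. Then the projection $x=\pi^m_n(\xi)=\operatorname{argmin}_{x\in\mathbb R^n}\|\xi\,\vec{\vdash}\,x\|_{\mathcal V}$ of $\xi$ on $\mathbb R^n$ is determined by $$x_i=\frac1\beta\sum_{j=1}^{\beta}\eta_{(i-1)\beta+j},\qquad i=1,\dots,n.$$ Moreover, $\xi\,\vec{\vdash}\,x$ is orthogonal to $x$, that is, $\langle \xi\,\vec{\vdash}\,\pi^m_n(\xi),\ \pi^m_n(\xi)\rangle_{\mathcal V}=0$.
   Context: $\mathcal V=\bigcup_{n=1}^\infty \mathbb R^n$ (disjoint union, column vectors). $\mathbf 1_k\in\mathbb R^k$ is the all-ones vector, $\otimes$ the Kronecker product. For $x\in\mathbb R^m$, $y\in\mathbb R^n$ and $t=\mathrm{lcm}(m,n)$: $x\,\vec{+}\,y:=(x\otimes \mathbf 1_{t/m})+(y\otimes \mathbf 1_{t/n})\in\mathbb R^t$; $x\,\vec{\vdash}\,y:=x\,\vec{+}\,(-y)$; $\langle x,y\rangle_{\mathcal V}:=\frac1t\langle x\otimes \mathbf 1_{t/m},\,y\otimes \mathbf 1_{t/n}\rangle$ (standard inner product of $\mathbb R^t$ on the right); $\|x\|_{\mathcal V}:=\sqrt{\langle x,x\rangle_{\mathcal V}}$. *)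

(* Defs.v *)
From mathcomp Require Import all_boot all_order all_algebra.
From mathcomp Require Import mxtens.
From mathcomp Require Import boolp classical_sets reals.

Set Implicit Arguments.
Unset Strict Implicit.
Unset Printing Implicit Defensive.

Import Order.TTheory GRing.Theory Num.Theory.

Local Open Scope ring_scope.
Local Open Scope classical_set_scope.

(* The disjoint union V of the spaces R^n is represented by the dimension-indexed
   family 'cV[R]_n: an operation on V is a function that takes the dimensions of
   its arguments as implicit parameters. The definitions make sense for all
   dimensions, but only positive ones are part of V. *)

Lemma muln_divK (m t : nat) : (m %| t)%N -> (m * (t %/ m))%N = t.
Proof. by move=> mt; rewrite mulnC divnK. Qed.

(* x (x) 1_{t/m}. The Kronecker product has type 'M_(m * (t %/ m), 1 * 1); the
   cast only identifies these dimensions with t and 1. *)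
Definition vlift (R : realType) (m t : nat) (mt : (m %| t)%N) (x : 'cV[R]_m) :
    'cV[R]_t :=
  castmx (muln_divK mt, muln1 1)
    (tensmx x (const_mx 1 : 'cV[R]_(t %/ m))).

Definition vadd (R : realType) (m n : nat) (x : 'cV[R]_m) (y : 'cV[R]_n) :
    'cV[R]_(lcmn m n) :=
  vlift (dvdn_lcml m n) x + vlift (dvdn_lcmr m n) y.

Definition vsub (R : realType) (m n : nat) (x : 'cV[R]_m) (y : 'cV[R]_n) :
    'cV[R]_(lcmn m n) :=
  vadd x (- y).

Definition dotcV (R : realType) (t : nat) (u v : 'cV[R]_t) : R :=
  \sum_(k < t) u k 0 * v k 0.

Definition vinner (R : realType) (m n : nat) (x : 'cV[R]_m) (y : 'cV[R]_n) : R :=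
  (lcmn m n)%:R^-1 *
    dotcV (vlift (dvdn_lcml m n) x) (vlift (dvdn_lcmr m n) y).

Definition vnorm (R : realType) (m : nat) (x : 'cV[R]_m) : R :=
  Num.sqrt (vinner x x).

Definition argmin_dist (R : realType) (m : nat) (xi : 'cV[R]_m) (n : nat) :
    set 'cV[R]_n :=
  [set x | forall y : 'cV[R]_n, vnorm (vsub xi x) <= vnorm (vsub xi y)].

Arguments argmin_dist {R m} xi n.

(* The default value 0 is taken only if there is no minimizer. *)
Definition vproj (R : realType) (m n : nat) (xi : 'cV[R]_m) : 'cV[R]_n :=
  xget 0 (argmin_dist xi n).
Arguments vproj {R m} n xi.

Lemma block_index_subproof (n t : nat) (nt : (n %| t)%N)
  (i : 'I_n) (j : 'I_(t %/ n)) : (i * (t %/ n) + j < t)%N.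
Proof.
by rewrite -[X in (_ < X)%N](muln_divK nt); exact: (mxtens_index_proof (i, j)).
Qed.

(* With i and j counted from 0, this is the j-th index of the i-th of the n
   consecutive blocks of length t / n. *)
Definition block_index (n t : nat) (nt : (n %| t)%N)
    (i : 'I_n) (j : 'I_(t %/ n)) : 'I_t :=
  Ordinal (block_index_subproof nt i j).

(* Main.v *)
Require Import Defs.
From mathcomp Require Import all_boot all_order all_algebra.
From mathcomp Require Import boolp classical_sets reals.
From mathcomp Require Import mxtens ring.

(** The lift of [y] in R^n to R^t is constant on each of the n blocks of length
    t / n, so a vector of R^t is orthogonal to all lifts exactly when its blocks
    have zero sums. The lift of the vector [x] of block means of [eta] thus
    leaves a residual orthogonal to all lifts, and Pythagoras' identity
    |eta - lift y|^2 = |eta - lift x|^2 + |lift (x - y)|^2 shows that [x] is the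
    unique minimizer. *)

Import Order.TTheory GRing.Theory Num.Theory.

Local Open Scope ring_scope.
Local Open Scope classical_set_scope.

(** Up to the cast, [block_index nt i j] is the Kronecker index of the pair [(i, j)], and the second
    tensor factor contributes an entry 1. *)
Lemma vlift_block {R : realType} {n t : nat} (nt : (n %| t)%N) (x : 'cV[R]_n)
    (i : 'I_n) (j : 'I_(t %/ n)) :
  vlift nt x (block_index nt i j) 0 = x i 0.
Proof.
rewrite /vlift castmxE.
have -> : cast_ord (esym (muln_divK nt)) (block_index nt i j)
          = mxtens_index (i, j) by exact: val_inj.
have -> : cast_ord (esym (muln1 1)) 0 = mxtens_index (0 : 'I_1, 0 : 'I_1).
  exact: val_inj.
by rewrite tensmxE mxE mulr1.
Qed.

Lemma block_index_surj {n t : nat} (nt : (n %| t)%N) (k : 'I_t) :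
  exists i j, k = block_index nt i j.
Proof.
set k' := cast_ord (esym (muln_divK nt)) k.
exists (mxtens_unindex k').1, (mxtens_unindex k').2; apply: val_inj => /=.
by rewrite -[LHS]/(val k') -{1}(mxtens_unindexK k') /=.
Qed.

Lemma sum_block {V : nmodType} {n t : nat} (nt : (n %| t)%N) (F : 'I_t -> V) :
  \sum_k F k = \sum_i \sum_j F (block_index nt i j).
Proof.
rewrite pair_big /= (reindex (fun p => block_index nt p.1 p.2)) //=.
(* The inverse of block indexing is the unindexing of Kronecker indices. *)
apply: onW_bij; exists (fun k => mxtens_unindex (cast_ord (esym (muln_divK nt)) k)).
  case=> i j /=; rewrite -[RHS]mxtens_indexK; congr mxtens_unindex.
  exact: val_inj.
move=> k; have [i [j ->]] := block_index_surj nt k.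
set k' := cast_ord _ _.
have -> : k' = mxtens_index (i, j) by exact: val_inj.
by rewrite mxtens_indexK.
Qed.

Lemma vliftB {R : realType} {n t : nat} (nt : (n %| t)%N) (x y : 'cV[R]_n) :
  vlift nt (x - y) = vlift nt x - vlift nt y.
Proof.
apply/colP => k; have [i [j ->]] := block_index_surj nt k.
by rewrite [RHS]mxE [in RHS]mxE !vlift_block !mxE.
Qed.

Lemma vliftN {R : realType} {n t : nat} (nt : (n %| t)%N) (x : 'cV[R]_n) :
  vlift nt (- x) = - vlift nt x.
Proof.
apply/colP => k; have [i [j ->]] := block_index_surj nt k.
by rewrite [RHS]mxE !vlift_block mxE.
Qed.

Lemma vlift_id {R : realType} {t : nat} (tt : (t %| t)%N) (x : 'cV[R]_t) :
  vlift tt x = x.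
Proof.
apply/colP => k; have [i [j ->]] := block_index_surj tt k.
rewrite vlift_block; congr (x _ 0); apply: val_inj => /=.
have t0 : (0 < t)%N by case: (t) k => // -[].
(* Blocks have length [t %/ t = 1], so [j] is 0 and the index [i * 1 + j] is [i]. *)
by case: j; rewrite divnn t0 /= => -[|//] _; rewrite muln1 addn0.
Qed.

(** The lift is constant on each block and factors out of the inner sum: the adjoint of lifting is
    the map taking block sums. *)
Lemma dotcV_vliftr {R : realType} {n t : nat} (nt : (n %| t)%N)
    (a : 'cV[R]_t) (u : 'cV[R]_n) :
  dotcV a (vlift nt u) = \sum_i (\sum_j a (block_index nt i j) 0) * u i 0.
Proof.
rewrite /dotcV (sum_block nt); apply: eq_bigr => i _.
by rewrite mulr_suml; apply: eq_bigr => j _; rewrite vlift_block.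
Qed.

Lemma vinner_dvdr {R : realType} {n t : nat} (nt : (n %| t)%N)
    (a : 'cV[R]_t) (u : 'cV[R]_n) :
  vinner a u = t%:R^-1 * dotcV a (vlift nt u).
Proof.
(* The divisibility proofs are generalized so that [lcmn t n] can be replaced by [t] in the types
   depending on it. *)
rewrite /vinner; move: (dvdn_lcml t n) (dvdn_lcmr t n).
have -> : lcmn t n = t by apply/eqP; rewrite eqn_dvd dvdn_lcml dvdn_lcm dvdnn nt.
by move=> tt nt'; rewrite vlift_id (bool_irrelevance nt' nt).
Qed.

Lemma dotcV_ge0 {R : realType} {t : nat} (a : 'cV[R]_t) : 0 <= dotcV a a.
Proof. by apply: sumr_ge0 => k _; rewrite -expr2 sqr_ge0. Qed.

Lemma dotcV_eq0 {R : realType} {t : nat} (a : 'cV[R]_t) :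
  dotcV a a = 0 -> a = 0.
Proof.
move=> /eqP; rewrite psumr_eq0; last by move=> k _; rewrite -expr2 sqr_ge0.
move=> /allP a0; apply/colP => k; rewrite mxE.
by apply/eqP; have := a0 k (mem_index_enum k); rewrite /= mulf_eq0 orbb.
Qed.

Lemma dotcV_pythagoras {R : realType} {t : nat} (a b : 'cV[R]_t) :
  dotcV a b = 0 -> dotcV (a + b) (a + b) = dotcV a a + dotcV b b.
Proof.
move=> ab; transitivity (dotcV a a + dotcV b b + dotcV a b *+ 2).
  rewrite /dotcV -sumrMnl -!big_split /=; apply: eq_bigr => k _.
  by rewrite !mxE; ring.
by rewrite ab mul0rn addr0.
Qed.

Lemma vnorm_le {R : realType} {t : nat} (a b : 'cV[R]_t) : (0 < t)%N ->
  (vnorm a <= vnorm b) = (dotcV a a <= dotcV b b).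
Proof.
move=> t0; rewrite /vnorm !(vinner_dvdr (dvdnn t)) !vlift_id.
have t0' : 0 < t%:R^-1 :> R by rewrite invr_gt0 ltr0n.
by rewrite ler_sqrt ?ler_pM2l // mulr_ge0 ?dotcV_ge0 // ltW.
Qed.

(** Blocks are nonempty, so the first entry of the [i]-th block recovers [x i 0]. This gives
    uniqueness of the minimizer. *)
Lemma vlift_inj {R : realType} {n t : nat} (nt : (n %| t)%N) : (0 < t)%N ->
  injective (vlift nt : 'cV[R]_n -> 'cV[R]_t).
Proof.
move=> t0 x y xy; apply/colP => i.
have b0 : (0 < t %/ n)%N by rewrite divn_gt0 ?(dvdn_gt0 t0 nt) // dvdn_leq.
by rewrite -(vlift_block nt x i (Ordinal b0)) xy vlift_block.
Qed.

Definition block_mean {R : realType} {n t : nat} (nt : (n %| t)%N)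
    (a : 'cV[R]_t) : 'cV[R]_n :=
  \col_i ((t %/ n)%:R^-1 * \sum_j a (block_index nt i j) 0).

(** On each block, subtracting the mean [t %/ n] times removes exactly the block sum, so the
    residual has zero block sums. *)
Lemma block_mean_orthogonal {R : realType} {n t : nat} (nt : (n %| t)%N)
    (a : 'cV[R]_t) (u : 'cV[R]_n) : (0 < t)%N ->
  dotcV (a - vlift nt (block_mean nt a)) (vlift nt u) = 0.
Proof.
move=> t0; rewrite dotcV_vliftr big1 // => i _.
have b0 : (t %/ n)%:R != 0 :> R.
  by rewrite pnatr_eq0 -lt0n divn_gt0 ?(dvdn_gt0 t0 nt) // dvdn_leq.
under eq_bigr do rewrite 2!mxE vlift_block.
rewrite sumrB sumr_const card_ord mxE -mulrnAl -mulr_natr mulVf //.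
by rewrite mul1r subrr mul0r.
Qed.

Lemma vsubE {R : realType} {m n : nat} (xi : 'cV[R]_m) (y : 'cV[R]_n) :
  vsub xi y = vlift (dvdn_lcml m n) xi - vlift (dvdn_lcmr m n) y.
Proof. by rewrite /vsub /vadd vliftN. Qed.

Lemma argmin_dist_block_mean {R : realType} {m n : nat} (xi : 'cV[R]_m) :
  (0 < lcmn m n)%N ->
  argmin_dist xi n =
    [set block_mean (dvdn_lcmr m n) (vlift (dvdn_lcml m n) xi)].
Proof.
move=> t0; set nt := dvdn_lcmr m n; set a := vlift _ xi; set x := block_mean _ _.
(* The residual at [y] is the residual at [x] plus the lift of [x - y], and these two are
   orthogonal. *)
have pyth y : dotcV (vsub xi y) (vsub xi y) = dotcV (vsub xi x) (vsub xi x)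
    + dotcV (vlift nt (x - y)) (vlift nt (x - y)).
  rewrite -dotcV_pythagoras ?vsubE ?block_mean_orthogonal //.
  by rewrite vliftB addrA subrK.
apply/seteqP; split=> [y /= ymin|_ -> y].
  (* Comparing a minimizer [y] with [x] bounds the squared length of the lift of [x - y] by 0. *)
  have := ymin x; rewrite vnorm_le // pyth gerDl => le0.
  have /dotcV_eq0 : dotcV (vlift nt (x - y)) (vlift nt (x - y)) = 0.
    by apply/eqP; rewrite eq_le le0 dotcV_ge0.
  by rewrite vliftB => /subr0_eq /(vlift_inj _ t0) ->.
by rewrite vnorm_le // (pyth y) lerDl dotcV_ge0.
Qed.

Theorem mainTheorem2 (R : realType) (m n : nat) (hm : (0 < m)%N) (hn : (0 < n)%N)
    (xi : 'cV[R]_m) :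
  let t := lcmn m n in
  let beta := (t %/ n)%N in
  let eta : 'cV[R]_t := vlift (dvdn_lcml m n) xi in
  let x : 'cV[R]_n := vproj n xi in
  [/\ argmin_dist xi n = [set x],
      forall i : 'I_n,
        x i 0 = beta%:R^-1 *
          \sum_(j < beta) eta (block_index (dvdn_lcmr m n) i j) 0
    & vinner (vsub xi x) x = 0].
Proof.
move=> t beta eta x.
have t0 : (0 < t)%N by rewrite lcmn_gt0 hm hn.
have argminE : argmin_dist xi n = [set block_mean (dvdn_lcmr m n) eta].
  exact: argmin_dist_block_mean.
have xE : x = block_mean (dvdn_lcmr m n) eta.
  (* The set of minimizers is a singleton, so [xget] returns its element and not the default 0. *)
  by rewrite /x /vproj argminE; apply: (xgetPex 0 (P := [set _])); eexists.
rewrite xE; split=> // [i|]; first by rewrite mxE.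
(* As [n] divides the dimension of the residual, only [x] has to be lifted, and the residual is
   orthogonal to every lift. *)
by rewrite (vinner_dvdr (dvdn_lcmr m n)) vsubE block_mean_orthogonal // mulr0.
Qed.
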